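(* Let $X$ be a set, $\mathcal{A}$ an algebra of subsets of $X$, and $\mu$ a finite content on $\mathcal{A}$. Then $\mu$ has property (DD) if and only if $\mu$ is sliceable and has no atoms.
   Context: An algebra $\mathcal{A}$ of subsets of $X$ contains $\emptyset$ and is closed under complements and finite unions. A content is a set function $\mu:\mathcal{A}\to[0,\infty]$ with $\mu(\emptyset)=0$ which is finitely additive; it is finite if $\mu(X)<\infty$. A set $A\in\mathcal{A}$ is an atom of $\mu$ if $\mu(A)>0$ and every $B\in\mathcal{A}$ with $B\subset A$ satisfies $\mu(B)=0$ or $\mu(B)=\mu(A)$. $\mu$ is sliceable if for every $\varepsilon>0$ there are finitely many mutually disjoint sets $B_1,\dots,B_n\in\mathcal{A}$ with $0<\mu(B_i)\le\varepsilon$ and $X=B_1\cup\dots\cup B_n$. $\mu$ has property (DD) if for every $A\in\mathcal{A}$ and every $\alpha\in(0,1)$ there is an increasing sequence $B^1_\alpha\subset B^2_\alpha\subset\cdots$ of sets in $\mathcal{A}$ with $B^n_\alpha\subset A$ for all $n$ and $\sup_{n}\mu(B^n_\alpha)=\alpha\,\mu(A)$.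
   Formalization: The content is assumed nonzero, μ(X) > 0: the zero content on a nonempty X has property (DD) and no atoms, but is not sliceable, since sliceability asks for sets with μ(B_i) > 0 covering X. *)

(* Defs.v *)
From HB Require Import structures.
From mathcomp Require Import all_boot all_order all_algebra.
From mathcomp Require Import all_classical all_reals all_analysis.

Set Implicit Arguments.
Unset Strict Implicit.
Unset Printing Implicit Defensive.

Local Open Scope classical_set_scope.
Local Open Scope ring_scope.
Local Open Scope ereal_scope.

Definition is_atom (d : measure_display) (T : algebraOfSetsType d)
    (R : realType) (mu : set T -> \bar R) (A : set T) : Prop :=
  [/\ measurable A, 0 < mu A &
    forall B, measurable B -> B `<=` A -> mu B = 0 \/ mu B = mu A].

Definition sliceable (d : measure_display) (T : algebraOfSetsType d)
    (R : realType) (mu : set T -> \bar R) : Prop :=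
  forall eps : R, (0 < eps)%R ->
  exists (n : nat) (B : 'I_n -> set T),
    [/\ forall i, measurable (B i),
        trivIset [set: 'I_n] B,
        forall i, 0 < mu (B i) /\ mu (B i) <= eps%:E &
        [set: T] = \bigcup_(i in [set: 'I_n]) B i].

Definition property_DD (d : measure_display) (T : algebraOfSetsType d)
    (R : realType) (mu : set T -> \bar R) : Prop :=
  forall A : set T, measurable A ->
  forall alpha : R, (0 < alpha)%R -> (alpha < 1)%R ->
  exists B : nat -> set T,
    [/\ forall n, measurable (B n),
        forall n, B n `<=` B n.+1,
        forall n, B n `<=` A &
        ereal_sup (range (fun n => mu (B n))) = alpha%:E * mu A].

(* Main.v *)
Require Import Defs.
From HB Require Import structures.
From mathcomp Require Import all_boot all_order all_algebra.
From mathcomp Require Import all_classical all_reals all_analysis.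
From mathcomp Require Import lra.

(** From (DD) with [alpha = 1/2], every set [A] of positive content contains a
    measurable [B] with [mu A / 3 < mu B <= mu A / 2]; hence there are no atoms.
    Splitting a set of content more than [eps] in this way removes at least
    [eps / 3] from both pieces, so finitely many rounds give a slicing of [T].

    Conversely, given [B] included in [A] with [mu B <= t <= mu A], adjoin the
    traces on [A] of an [eps]-slicing one at a time, and stop just before the
    content exceeds [t]: the result has content in [[t - eps, t]]. Iterating
    with [eps = 1/(n+1)] and [t = alpha * mu A] gives the sequence of (DD). *)

Local Open Scope classical_set_scope.
Local Open Scope ring_scope.
Local Open Scope ereal_scope.

Import Order.TTheory GRing.Theory Num.Theory.

Set Implicit Arguments.
Unset Strict Implicit.

Lemma content_fin_num (d : measure_display) (T : algebraOfSetsType d)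
    (R : realType) (mu : {content set T -> \bar R}) (A : set T) :
  mu [set: T] < +oo -> measurable A -> mu A \is a fin_num.
Proof.
move=> mu_fin mA; rewrite ge0_fin_numE ?measure_ge0//.
by apply: le_lt_trans mu_fin; apply: le_measure => //; rewrite inE.
Qed.

(** The supremum [mu A / 2] exceeds [mu A / 3], hence so does the content of some term of the
    sequence, and no term exceeds the supremum. *)
Lemma property_DD_split (d : measure_display) (T : algebraOfSetsType d)
    (R : realType) (mu : {content set T -> \bar R}) (A : set T) :
  mu [set: T] < +oo -> property_DD mu -> measurable A -> 0 < mu A ->
  exists B, [/\ measurable B, B `<=` A,
    (fine (mu A) / 3 < fine (mu B))%R & (fine (mu B) <= fine (mu A) / 2)%R].
Proof.
move=> mu_fin DD mA A0.
have finA := content_fin_num mu_fin mA.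
have [B [mB _ BA supB]] : exists B : nat -> set T, [/\ forall n, measurable (B n),
    forall n, B n `<=` B n.+1, forall n, B n `<=` A &
    ereal_sup (range (fun n => mu (B n))) = (2^-1)%:E * mu A].
  by apply: DD => //; lra.
have a0 : (0 < fine (mu A))%R by rewrite -lte_fin fineK.
have : (fine (mu A) / 3)%:E < ereal_sup (range (fun n => mu (B n))).
  by rewrite supB -[mu A in ltRHS]fineK// -EFinM lte_fin; lra.
move=> /ereal_sup_gt[_ [n _ <-] ltB].
have finB := content_fin_num mu_fin (mB n).
exists (B n); split => //; first by rewrite -lte_fin fineK.
have : mu (B n) <= ereal_sup (range (fun n => mu (B n))).
  by apply: ereal_sup_ubound; exists n.
by rewrite supB -[mu A]fineK// -[mu (B n)]fineK// -EFinM lee_fin/=; lra.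
Qed.

Lemma property_DD_no_atom (d : measure_display) (T : algebraOfSetsType d)
    (R : realType) (mu : {content set T -> \bar R}) (A : set T) :
  mu [set: T] < +oo -> property_DD mu -> ~ is_atom mu A.
Proof.
move=> mu_fin DD [mA A0 atomA].
have [B [mB BA ltB leB]] := property_DD_split mu_fin DD mA A0.
have a0 : (0 < fine (mu A))%R by rewrite -lte_fin fineK// content_fin_num.
(* Neither 0 nor [mu A] lies in the half-open interval from [mu A / 3] to [mu A / 2], since [mu A]
   is positive. *)
by case: (atomA B mB BA) => EB; rewrite EB/= in ltB leB; clear -ltB leB a0; lra.
Qed.

(** The condition of [sliceable] relative to a set [A], so that it can be proved by splitting [A];
    at [A = [set: T]] it is that condition. *)
Definition slicing (d : measure_display) (T : algebraOfSetsType d)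
    (R : realType) (mu : set T -> \bar R) (eps : R) (A : set T)
    (n : nat) (B : 'I_n -> set T) : Prop :=
  [/\ forall i, measurable (B i),
      trivIset [set: 'I_n] B,
      forall i, 0 < mu (B i) /\ mu (B i) <= eps%:E &
      A = \bigcup_(i in [set: 'I_n]) B i].

Lemma slicing_setU (d : measure_display) (T : algebraOfSetsType d)
    (R : realType) (mu : set T -> \bar R) (eps : R) (A1 A2 : set T)
    (n1 n2 : nat) (B1 : 'I_n1 -> set T) (B2 : 'I_n2 -> set T) :
  A1 `&` A2 = set0 -> slicing mu eps A1 B1 ->
  slicing mu eps A2 B2 ->
  slicing (n := n1 + n2) mu eps (A1 `|` A2)
    (fun i => match fintype.split i with inl j => B1 j | inr j => B2 j end).
Proof.
move=> A12 [mB1 tB1 eB1 cB1] [mB2 tB2 eB2 cB2].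
have dis i j x : B1 i x -> B2 j x -> False.
  move=> xi xj; suff : (A1 `&` A2) x by rewrite A12.
  by split; [rewrite cB1; exists i|rewrite cB2; exists j].
split.
- by move=> i; case: (fintype.split i).
(* Writing each index as [unsplit] of its [split] reduces the equality of indices to one within a
   single family. *)
- move=> i j _ _ [x []]; rewrite -[X in _ -> _ -> X = _]splitK.
  rewrite -[X in _ -> _ -> _ = X]splitK.
  case: (fintype.split i) (fintype.split j) => i' [j'|j'] xi xj.
  + by congr (unsplit (inl _)); apply: tB1 => //; exists x.
  + by case: (dis _ _ _ xi xj).
  + by case: (dis _ _ _ xj xi).
  + by congr (unsplit (inr _)); apply: tB2 => //; exists x.
- by move=> i; case: (fintype.split i).
- rewrite cB1 cB2; apply/seteqP; split => x.
  + by move=> [[i _ xi]|[i _ xi]];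
      [exists (unsplit (inl i))|exists (unsplit (inr i))]; rewrite ?unsplitK.
  + by move=> [i _]; case: (fintype.split i) => j xj; [left|right]; exists j.
Qed.

(** Induction on [k], a bound on the depth of splitting. If [mu A > eps], both [B] and its
    complement in [A] have content at most [mu A - eps / 3], so [k - 1] suffices for them. *)
Lemma property_DD_slicing (d : measure_display) (T : algebraOfSetsType d)
    (R : realType) (mu : {content set T -> \bar R}) (eps : R) (k : nat)
    (A : set T) :
  mu [set: T] < +oo -> property_DD mu -> (0 < eps)%R ->
  measurable A -> 0 < mu A -> (fine (mu A) <= eps + k%:R * (eps / 3))%R ->
  exists (n : nat) (B : 'I_n -> set T), slicing mu eps A B.
Proof.
move=> mu_fin DD eps0.
have slicing1 C : measurable C -> 0 < mu C -> (fine (mu C) <= eps)%R ->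
    exists (n : nat) (B : 'I_n -> set T), slicing mu eps C B.
  move=> mC C0 Ceps; exists 1%N, (fun=> C); split => //.
  - by move=> i j _ _ _; rewrite !ord1.
  - by move=> _; rewrite -[X in _ /\ X <= _]fineK ?content_fin_num// lee_fin.
  - by apply/seteqP; split => [x Cx|x []//]; exists ord0.
elim: k A => [|k IH] A mA A0 leA; first by apply: slicing1 => //; lra.
have [|ltA] := leP (fine (mu A)) eps; first exact: slicing1.
have [B [mB BA ltB leB]] := property_DD_split mu_fin DD mA A0.
have mAB : measurable (A `\` B) by exact: measurableD.
have muD : fine (mu (A `\` B)) = (fine (mu A) - fine (mu B))%R.
  rewrite measureD//; last by rewrite -ge0_fin_numE ?measure_ge0 ?content_fin_num.
  by rewrite setIidr// fineB ?content_fin_num.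
have kS : (k.+1%:R * (eps / 3) = k%:R * (eps / 3) + eps / 3)%R.
  by rewrite -addn1 natrD mulrDl mul1r.
rewrite kS in leA.
have [||n1 [B1 sB1]] := IH B mB.
- by rewrite -[mu B]fineK ?content_fin_num// lte_fin; lra.
- by lra.
have [||n2 [B2 sB2]] := IH _ mAB.
- by rewrite -[mu (_ `\` _)]fineK ?content_fin_num// lte_fin muD; lra.
- by rewrite muD; lra.
exists (n1 + n2)%N; eexists.
rewrite -(setDUK BA); apply: slicing_setU sB1 sB2.
exact: setDIK.
Qed.

Lemma property_DD_sliceable (d : measure_display) (T : algebraOfSetsType d)
    (R : realType) (mu : {content set T -> \bar R}) :
  mu [set: T] < +oo -> 0 < mu [set: T] -> property_DD mu -> sliceable mu.
Proof.
move=> mu_fin mu_neq0 DD eps eps0.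
(* This [k] exceeds [mu setT / (eps / 3)], so [k] steps of size [eps / 3] already cover
   [mu setT]. *)
apply: (@property_DD_slicing _ _ _ mu eps
  (Num.trunc (fine (mu setT) / (eps / 3))).+1) => //.
have := truncnS_gt (fine (mu setT) / (eps / 3))%R.
by rewrite ltr_pdivrMr; lra.
Qed.

(** Induction on [s], with [B] the union accumulated so far. *)
Lemma greedy_setU (d : measure_display) (T : algebraOfSetsType d)
    (R : realType) (mu : {content set T -> \bar R}) (eps t : R)
    (I : Type) (D : I -> set T) (s : seq I) (B : set T) :
  mu [set: T] < +oo -> (0 <= eps)%R -> (forall i, measurable (D i)) ->
  (forall i, mu (D i) <= eps%:E) -> measurable B ->
  mu B <= t%:E -> t%:E <= mu (B `|` \big[setU/set0]_(i <- s) D i) ->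
  exists C, [/\ measurable C, B `<=` C, C `<=` B `|` \big[setU/set0]_(i <- s) D i,
    mu C <= t%:E & (t - eps)%:E <= mu C].
Proof.
move=> mu_fin eps0 mD leD; elim: s B => [|i s IH] B mB leB.
  rewrite big_nil setU0 => geB; exists B; split => //.
  by apply: le_trans geB; rewrite lee_fin; lra.
rewrite big_cons setUA => geB.
have [leBD|ltBD] := leP (mu (B `|` D i)) t%:E.
  have [C [mC BC CB leC geC]] := IH _ (measurableU _ _ mB (mD i)) leBD geB.
  by exists C; split => // x Bx; apply: BC; left.
(* Adding [D i] would overshoot, so [B] is kept: [t < mu (B U D i) <= mu B + eps] by
   subadditivity. *)
exists B; split => //; first by move=> x; left; left.
rewrite EFinB leeBlDr//; apply: (le_trans (ltW ltBD)).
by apply: le_trans (measureU2 _ mB (mD i)) _; rewrite leeD2l.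
Qed.

Lemma sliceable_approx (d : measure_display) (T : algebraOfSetsType d)
    (R : realType) (mu : {content set T -> \bar R}) (eps t : R) (A B : set T) :
  mu [set: T] < +oo -> sliceable mu -> (0 < eps)%R ->
  measurable A -> measurable B -> B `<=` A -> mu B <= t%:E -> t%:E <= mu A ->
  exists C, [/\ measurable C, B `<=` C, C `<=` A,
    mu C <= t%:E & (t - eps)%:E <= mu C].
Proof.
move=> mu_fin slmu eps0 mA mB BA leB geA.
have [n [D [mD _ leD cD]]] := slmu eps eps0.
have EA : A = B `|` \big[setU/set0]_(i <- index_enum 'I_n) (A `&` D i).
  rewrite -bigcup_seq; apply/seteqP; split => x.
    move=> Ax; right; have : [set: T] x by [].
    by rewrite cD => -[i _ Dix]; exists i => //=; rewrite mem_index_enum.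
  by move=> [/BA//|[i _ []]].
rewrite [in t%:E <= _]EA in geA.
have mAD i : measurable (A `&` D i) by exact: measurableI.
have [||C [mC BC CA leC geC]] :=
  greedy_setU (eps := eps) mu_fin _ mAD _ mB leB geA.
- exact: ltW.
- move=> i; apply: le_trans (leD i).2.
  by apply: le_measure; rewrite ?inE//; exact: subIsetr.
by exists C; rewrite -EA in CA; split.
Qed.

Lemma sliceable_property_DD (d : measure_display) (T : algebraOfSetsType d)
    (R : realType) (mu : {content set T -> \bar R}) :
  mu [set: T] < +oo -> sliceable mu -> property_DD mu.
Proof.
move=> mu_fin slmu A mA alpha alpha0 alpha1.
have finA := content_fin_num mu_fin mA.
set t := (alpha * fine (mu A))%R.
have a0 : (0 <= fine (mu A))%R by rewrite fine_ge0.
have tA : t%:E <= mu A.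
  by rewrite -[mu A]fineK// lee_fin /t ler_piMl// ltW.
have t0 : (0 <= t)%R by rewrite /t mulr_ge0// ltW.
(* The invariant is packed into a sigma type so that [choice] yields a total step function; the
   index [p.1] sets the precision. *)
pose good (B : set T) := [/\ measurable B, B `<=` A & mu B <= t%:E].
have step (p : nat * {B | good B}) : exists C : {B | good B},
    sval p.2 `<=` sval C /\ (t - p.1.+1%:R^-1)%:E <= mu (sval C).
  case: p => n [B [mB BA leB]] /=.
  have [|C [mC BC CA leC geC]] :=
    @sliceable_approx _ _ _ mu n.+1%:R^-1 t A B mu_fin slmu _ mA mB BA leB tA.
    by rewrite invr_gt0.
  have gC : good C by [].
  by exists (exist _ C gC).
have [next nextP] := choice step.
have g0 : good set0 by split; rewrite ?measure0 ?lee_fin.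
(* The sequence starts at the empty set, and its term [n.+1] has content within [1/(n+1)] of [t]. *)
pose S := fix S n := if n is m.+1 then next (m, S m) else exist _ set0 g0.
exists (fun n => sval (S n)); split.
- by move=> n; case: (svalP (S n)).
- by move=> n; case: (nextP (n, S n)).
- by move=> n; case: (svalP (S n)).
rewrite -[mu A]fineK// -EFinM -/t; apply/eqP; rewrite eq_le; apply/andP; split.
  by apply: ge_ereal_sup => _ [n _ <-]; case: (svalP (S n)).
apply/lee_addgt0Pr => e e0; rewrite -leeBlDr//.
(* Then [n + 1 > 1/e], so the term [n.+1] has content at least [t - e]. *)
set n := Num.trunc e^-1.
apply: (@le_trans _ _ (mu (sval (S n.+1)))); last first.
  by apply: ereal_sup_ubound; exists n.+1.
apply: le_trans (nextP (n, S n)).2; rewrite -EFinB lee_fin lerD2l lerN2.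
by rewrite invf_ple ?posrE// ltW// truncnS_gt.
Qed.

(* With the strict bound [0 < mu (B i)] in [sliceable], the zero content on a
   nonempty set satisfies (DD) but is not sliceable; [mu_neq0] excludes it. *)
Theorem theorem2 (d : measure_display) (T : algebraOfSetsType d)
    (R : realType) (mu : {content set T -> \bar R})
    (mu_fin : mu [set: T] < +oo) (mu_neq0 : 0 < mu [set: T]) :
  property_DD mu <-> (sliceable mu /\ forall A : set T, ~ is_atom mu A).
Proof.
split => [DD|[slmu _]]; last exact: sliceable_property_DD.
by split; [exact: property_DD_sliceable|move=> A; exact: property_DD_no_atom].
Qed.
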